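(* Let $d=2$ and $\gamma=1$. Then the adaptive multiresolution stream phase matches that of the reference scheme at order $s=3$; that is, for every $\Delta\ell\ge0$ and every dimensionless velocity $c=(c_x,c_y)\in\mathbb{Z}^2$ with $\max(|c_x|,|c_y|)\le 2$, the flattened weights satisfy $$\sum_{m,n=-2}^{2}C_{\Delta\ell,m,n}=0,\qquad \sum_{m,n=-2}^{2}m^{p_x}n^{p_y}C_{\Delta\ell,m,n}=\frac{(-c_x)^{p_x}(-c_y)^{p_y}}{2^{\Delta\ell(p_x+p_y-2)}}$$ for all $p_x,p_y\in\{0,1,2,3\}$ with $(p_x,p_y)\neq(0,0)$.
   Context: Setting ($d=2$). Cells of level $\ell$ are indexed by $k=(k_x,k_y)\in\mathbb{Z}^2$; $\overline{L}$ is the finest level and $\Delta\ell=\overline{L}-\ell\ge 0$. The cell $(\ell,k)$ has the four children $(\ell+1,2k+\delta)$, $\delta\in\{0,1\}^2$. A distribution function moves with dimensionless velocity $c=(c_x,c_y)\in\mathbb{Z}^2$, and one assumes $\max(|c_x|,|c_y|)\le 2$ for all velocities. Let $(f_k)_{k\in\mathbb{Z}^2}$ be the (post-collision) cell averages at level $\ell$ (the mesh is uniform at level $\ell$). Prediction and reconstruction for $\gamma=1$: the prediction operator is the tensor product of the one-dimensional one, i.e. with $a^{\delta}_{0}=1$, $a^{\delta}_{-1}=(-1)^\delta/8$, $a^{\delta}_{1}=-(-1)^\delta/8$ for $\delta\in\{0,1\}$, $$\hat g_{2k+\delta}=\sum_{i=-1}^{1}\sum_{j=-1}^{1}a^{\delta_x}_i\,a^{\delta_y}_j\,g_{k+(i,j)},\qquad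 \delta=(\delta_x,\delta_y)\in\{0,1\}^2 .$$ The reconstruction $(\hat{\hat f}_{\overline k})_{\overline k\in\mathbb{Z}^2}$ on the finest level $\overline{L}$ is obtained from $(f_k)_k$ by applying the prediction operator recursively $\Delta\ell$ times (if $\Delta\ell=0$ it is $f$ itself). Multiresolution stream phase: with $\mathcal{B}_k=\{2^{\Delta\ell}k+\delta:\ \delta\in\{0,\dots,2^{\Delta\ell}-1\}^2\}$, $\mathcal{E}_k=(\mathcal{B}_k-c)\setminus\mathcal{B}_k$, $\mathcal{A}_k=\mathcal{B}_k\setminus(\mathcal{B}_k-c)$, the updated average on cell $(\ell,k)$ is $$f_k+\frac{1}{4^{\Delta\ell}}\Big(\sum_{\overline k\in\mathcal{E}_k}\hat{\hat f}_{\overline k}-\sum_{\overline k\in\mathcal{A}_k}\hat{\hat f}_{\overline k}\Big).$$ Flattened weights: the real numbers $(C_{\Delta\ell,m,n})_{m,n=-2}^{2}$ (depending on $c$) such that, for all data $(f_k)_k$ and all $k$, $$\sum_{\overline k\in\mathcal{E}_k}\hat{\hat f}_{\overline k}-\sum_{\overline k\in\mathcal{A}_k}\hat{\hat f}_{\overline k}=\sum_{m=-2}^{2}\sum_{n=-2}^{2}C_{\Delta\ell,m,n}\,f_{k+(m,n)}.$$ Match: the adaptive stream phase matches that of the reference scheme at order $s\ge1$ if $\sum_{m,n}C_{\Delta\ell,m,n}=0$ and $\sum_{m,n}m^{p_x}n^{p_y}C_{\Delta\ell,m,n}=\frac{(-c_x)^{p_x}(-c_y)^{p_y}}{2^{\Delta\ell(p_x+p_y-2)}}$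 for all $p_x,p_y\in\{0,\dots,s\}$, $(p_x,p_y)\ne(0,0)$, for every $\Delta\ell\ge0$ and every velocity $c$ of the scheme. Convention: $0^0=1$. *)

(* Defs.v *)
From mathcomp Require Import all_boot all_order all_algebra.
From mathcomp Require Import finmap.
From mathcomp Require Import reals.

Set Implicit Arguments.
Unset Strict Implicit.
Unset Printing Implicit Defensive.

Import Order.TTheory GRing.Theory Num.Theory.
Local Open Scope fset_scope.
Local Open Scope ring_scope.

(* The coefficients a^delta_i of the one-dimensional prediction (gamma = 1);
   only delta in {0, 1} and i in {-1, 0, 1} are meaningful. *)
Definition pred_coef (R : realType) (delta i : int) : R :=
  if i == 0 then 1
  else if i == -1 then (-1) ^ delta / 8
  else - (-1) ^ delta / 8.

(* A fine index q is written 2 k + delta with k = q %/ 2 and delta = q %% 2;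
   the division of intdiv is Euclidean, so delta is in {0, 1} also if q < 0. *)
Definition predict (R : realType) (g : int * int -> R) (q : int * int) : R :=
  \sum_(i <- [:: -1; 0; 1] : seq int) \sum_(j <- [:: -1; 0; 1] : seq int)
    pred_coef R (q.1 %% 2)%Z i * pred_coef R (q.2 %% 2)%Z j *
    g ((q.1 %/ 2)%Z + i, (q.2 %/ 2)%Z + j).

Definition reconstruct (R : realType) (dl : nat) (f : int * int -> R) :
    int * int -> R :=
  iter dl (@predict R) f.

Definition cellB (dl : nat) (k : int * int) : {fset int * int} :=
  [fset ((2 ^ dl)%N%:Z * k.1 + i%:Z, (2 ^ dl)%N%:Z * k.2 + j%:Z)
   | i in iota 0 (2 ^ dl), j in iota 0 (2 ^ dl)].

Definition shiftB (dl : nat) (c k : int * int) : {fset int * int} :=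
  [fset (q.1 - c.1, q.2 - c.2) | q in cellB dl k].

Definition cellE (dl : nat) (c k : int * int) : {fset int * int} :=
  shiftB dl c k `\` cellB dl k.

Definition cellA (dl : nat) (c k : int * int) : {fset int * int} :=
  cellB dl k `\` shiftB dl c k.

(* The updated average of the stream phase is
   f k + 4 ^- dl * stream_flux dl c f k. *)
Definition stream_flux (R : realType) (dl : nat) (c : int * int)
    (f : int * int -> R) (k : int * int) : R :=
  \sum_(q <- cellE dl c k) reconstruct dl f q
  - \sum_(q <- cellA dl c k) reconstruct dl f q.

(* Weights C_{m,n} with m, n in {-2, ..., 2} are stored in a 5 x 5 matrix: the
   entry C i j is the weight of index (offset i, offset j). *)
Definition offset (i : 'I_5) : int := (i : nat)%:Z - 2.

Definition is_flattened_weights (R : realType) (dl : nat) (c : int * int)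
    (C : 'M[R]_5) : Prop :=
  forall (f : int * int -> R) (k : int * int),
    stream_flux dl c f k =
    \sum_(i < 5) \sum_(j < 5) C i j * f (k.1 + offset i, k.2 + offset j).

Definition match_conditions (R : realType) (s dl : nat) (c : int * int)
    (C : 'M[R]_5) : Prop :=
  \sum_(i < 5) \sum_(j < 5) C i j = 0 /\
  forall px py : nat, (px <= s)%N -> (py <= s)%N -> (px, py) <> (0%N, 0%N) ->
    \sum_(i < 5) \sum_(j < 5)
      (offset i)%:~R ^+ px * (offset j)%:~R ^+ py * C i j =
    (- c.1%:~R) ^+ px * (- c.2%:~R) ^+ py
      / 2 ^ (dl%:Z * (px%:Z + py%:Z - 2)).

(* V is the set of velocities of the scheme. "The" flattened weights are
   given by a definite description, hence the use of unique. *)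
Definition stream_phase_matches (R : realType) (V : int * int -> Prop)
    (s : nat) : Prop :=
  forall (dl : nat) (c : int * int), V c ->
    exists C : 'M[R]_5,
      unique (is_flattened_weights dl c) C /\ match_conditions s dl c C.

(* Main.v *)
Require Import Defs.
From mathcomp Require Import all_boot all_order all_algebra.
From mathcomp Require Import finmap zify ring.
From mathcomp Require Import reals.

Import Order.TTheory GRing.Theory Num.Theory.
Local Open Scope ring_scope.

(** The two-dimensional prediction is the tensor square of a one-dimensional
    one, so everything reduces to sums of reconstructed values over windows of
    [2 ^ dl] consecutive fine cells.  Write [S dl c] for such a sum over the
    parent cell shifted by [- c].  Refining once more splits each coarse cell in
    two; pairing consecutive fine cells in the window gives

      [S dl.+1 (2 e) = 2 S dl e],
      [S dl.+1 (2 e + 1) = 9/8 (S dl e + S dl (e + 1))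
                            - 1/8 (S dl (e - 1) + S dl (e + 2))].

    Up to the factor 2 this is the four-point interpolatory subdivision scheme
    of Deslauriers and Dubuc, acting on the shift [c] ([refine] below).  Three
    consequences give the result.

    - Shifts in [-2 .. 2] only call shifts in [-2 .. 2] ([refine_local]), and
      [S 0 c] is the single value at [k - c]; hence a five-point stencil
      suffices at all levels ([box_sum_reconstruct]).
    - The four-point scheme reproduces cubic polynomials ([refine_monomial]),
      although the prediction itself is exact on averages of quadratics only.
      This is why the order is 3: the moment of order [p] of the stencil with
      shift [c] is [(- c) ^ p * 2 ^ (dl * (1 - p))] for [p <= 3]
      ([weight_moment]).
    - The flux is the window sum with shift [c] minus the one with shift 0
      ([stream_flux_box_sum]).  Moments of tensor-product weights are products
      of one-dimensional moments, and shift 0 contributes only to the moment of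
      order [(0, 0)]. *)

(** * One-dimensional prediction and window sums *)

Definition predict1 {R : realType} (u : int -> R) (q : int) : R :=
  \sum_(i <- [:: -1; 0; 1] : seq int)
    pred_coef R (q %% 2)%Z i * u ((q %/ 2)%Z + i).

Definition window_sum {R : realType} (n : nat) (u : int -> R) (a : int) : R :=
  \sum_(i < n) u (a + i%:Z).

Definition refine {R : realType} (u : int -> R) (c : int) : R :=
  let e := (c %/ 2)%Z in
  if (c %% 2)%Z == 0 then 2 * u e
  else 9 / 8 * (u e + u (e + 1)) - 1 / 8 * (u (e - 1) + u (e + 2)).

Lemma refine_even (R : realType) (u : int -> R) (e : int) :
  refine u (2 * e) = 2 * u e.
Proof.
rewrite /refine.
have -> : (2 * e %% 2)%Z = 0 by lia.
by have -> : (2 * e %/ 2)%Z = e by lia.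
Qed.

Lemma refine_odd (R : realType) (u : int -> R) (e : int) :
  refine u (2 * e + 1) =
  9 / 8 * (u e + u (e + 1)) - 1 / 8 * (u (e - 1) + u (e + 2)).
Proof.
rewrite /refine.
have -> : ((2 * e + 1) %% 2)%Z = 1 by lia.
by have -> : ((2 * e + 1) %/ 2)%Z = e by lia.
Qed.

Variant parity_spec : int -> Prop :=
  | ParityEven e : parity_spec (2 * e)
  | ParityOdd e : parity_spec (2 * e + 1).

Lemma parityP (c : int) : parity_spec c.
Proof.
have [c0|c1] : c = 2 * (c %/ 2)%Z \/ c = 2 * (c %/ 2)%Z + 1 by lia.
- by rewrite c0; constructor.
- by rewrite c1; constructor.
Qed.

Lemma eq_refine (R : realType) (u v : int -> R) : u =1 v -> refine u =1 refine v.
Proof. by move=> uv c; rewrite /refine !uv. Qed.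

(** Halving brings a shift closer to 0 by enough to make room for the two extra
    neighbours of the mask.  This stability of [-2 .. 2] is what keeps
    the stencil bounded as the level difference grows. *)
Lemma refine_local (R : realType) (u v : int -> R) :
  (forall c, `|c| <= 2 -> u c = v c) ->
  forall c, `|c| <= 2 -> refine u c = refine v c.
Proof.
move=> uv c; case: (parityP c) => e ce.
- by rewrite !refine_even uv //; lia.
- by rewrite !refine_odd !uv //; lia.
Qed.

Lemma refine_sum (R : realType) (I : Type) (r : seq I) (F : I -> int -> R) c :
  refine (fun e => \sum_(i <- r) F i e) c = \sum_(i <- r) refine (F i) c.
Proof.
case: (parityP c) => e.
- rewrite refine_even mulr_sumr.
  by apply: eq_bigr => i _; rewrite refine_even.
- rewrite refine_odd -!big_split !mulr_sumr -sumrB.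
  by apply: eq_bigr => i _; rewrite refine_odd.
Qed.

Lemma refineZ (R : realType) (x : R) (u : int -> R) c :
  refine (fun e => x * u e) c = x * refine u c.
Proof. by case: (parityP c) => e; rewrite ?refine_even ?refine_odd; ring. Qed.

(** At odd points the mask is twice that of cubic Lagrange interpolation at the
    midpoint of [e] and [e + 1] from the nodes [e - 1], ..., [e + 2], hence
    exact up to degree 3; the power of 2 collects this factor 2 and the halving
    of the argument. *)
Lemma refine_monomial (R : realType) (p : nat) (c : int) : (p <= 3)%N ->
  refine (fun e => (- e%:~R : R) ^+ p) c = (- c%:~R) ^+ p * 2 ^ (1 - p%:Z).
Proof.
have -> : 2 ^ (1 - p%:Z) = 2 * (2 ^+ p)^-1 :> R.
  by rewrite expfzDr ?pnatr_eq0 // expr1z exprnN.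
case: (parityP c) => e.
- move=> _; rewrite refine_even intrM -mulrN exprMn.
  by field; rewrite expf_neq0 // pnatr_eq0.
- rewrite refine_odd !(intrD, intrM, intrB).
  by case: p => [|[|[|[|//]]]] _; rewrite ?expr0 ?expr1; field.
Qed.

Lemma eq_predict1 (R : realType) (u v : int -> R) :
  u =1 v -> predict1 u =1 predict1 v.
Proof. by move=> uv q; apply: eq_bigr => i _; rewrite uv. Qed.

Lemma predict1_sum (R : realType) (I : Type) (r : seq I) (F : I -> int -> R) q :
  predict1 (fun x => \sum_(i <- r) F i x) q = \sum_(i <- r) predict1 (F i) q.
Proof.
rewrite /predict1 exchange_big; apply: eq_bigr => j _.
by rewrite mulr_sumr.
Qed.

Lemma predict1_even (R : realType) (u : int -> R) (q : int) :
  predict1 u (2 * q) = u q + (u (q - 1) - u (q + 1)) / 8.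
Proof.
rewrite /predict1 !big_cons big_nil.
have -> : (2 * q %% 2)%Z = 0 by lia.
have -> : (2 * q %/ 2)%Z = q by lia.
by rewrite /pred_coef /= expr0z addr0; field.
Qed.

Lemma predict1_odd (R : realType) (u : int -> R) (q : int) :
  predict1 u (2 * q + 1) = u q - (u (q - 1) - u (q + 1)) / 8.
Proof.
rewrite /predict1 !big_cons big_nil.
have -> : ((2 * q + 1) %% 2)%Z = 1 by lia.
have -> : ((2 * q + 1) %/ 2)%Z = q by lia.
by rewrite /pred_coef /= expr1z addr0; field.
Qed.

Lemma window_sum_double (R : realType) (n : nat) (u : int -> R) (a : int) :
  window_sum n.*2 u a =
  \sum_(i < n) (u (a + 2 * i%:Z) + u (a + 2 * i%:Z + 1)).
Proof.
rewrite /window_sum; elim: n => [|n IHn]; first by rewrite !big_ord0.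
rewrite doubleS !big_ord_recr /= IHn -addrA; congr (_ + (u _ + u _)); lia.
Qed.

(** For an even shift the pairs of fine cells are siblings, and the prediction
    preserves their sum; for an odd shift a pair straddles two parents, and
    adding the two predictions gives the four-point mask. *)
Lemma window_sum_predict1 (R : realType) (n : nat) (u : int -> R) (a c : int) :
  window_sum n.*2 (predict1 u) (2 * a - c) =
  refine (fun e => window_sum n u (a - e)) c.
Proof.
rewrite window_sum_double; case: (parityP c) => e.
- rewrite refine_even mulr_sumr; apply: eq_bigr => i _.
  have -> : 2 * a - 2 * e + 2 * i%:Z = 2 * (a - e + i%:Z) by ring.
  by rewrite predict1_even predict1_odd; field.
- rewrite refine_odd -!big_split !mulr_sumr -sumrB; apply: eq_bigr => i _ /=.
  have -> : 2 * a - (2 * e + 1) + 2 * i%:Z = 2 * (a - e + i%:Z - 1) + 1 by ring.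
  have -> : 2 * (a - e + i%:Z - 1) + 1 + 1 = 2 * (a - e + i%:Z) by ring.
  rewrite predict1_even predict1_odd subrK.
  have -> : a - (e + 1) + i%:Z = a - e + i%:Z - 1 by ring.
  have -> : a - (e - 1) + i%:Z = a - e + i%:Z + 1 by ring.
  have -> : a - (e + 2) + i%:Z = a - e + i%:Z - 1 - 1 by ring.
  by field.
Qed.

(** * One-dimensional weights and their moments *)

(** The weight of offset [i] in the window sum with shift [c]: since [refine] is
    linear, it is the subdivision scheme's response to the level-0 weight, which
    is 1 when the offset is [- c] and 0 otherwise. *)
Definition weight (R : realType) (dl : nat) (i : 'I_5) (c : int) : R :=
  iter dl refine (fun e => (offset i == - e)%:R) c.

Lemma sum_offset_delta (R : realType) (F : int -> R) (c : int) : `|c| <= 2 ->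
  \sum_(i < 5) F (offset i) * (offset i == - c)%:R = F (- c).
Proof.
move=> c2; have i_lt : (absz (2 - c) < 5)%N by lia.
rewrite (bigD1 (Ordinal i_lt)) //= big1 => [|i /eqP ni]; last first.
  have -> : (offset i == - c) = false; last by rewrite mulr0.
  apply/negP => /eqP ic; apply: ni; apply: val_inj => /=.
  by move: ic; rewrite /offset; lia.
have -> : offset (Ordinal i_lt) = - c by rewrite /offset /=; lia.
by rewrite eqxx mulr1 addr0.
Qed.

(** Moments are linear in the weights, so they commute with [refine]; being
    monomials in the shift at level 0, they stay so at all levels. *)
Lemma weight_moment (R : realType) (dl p : nat) (c : int) :
  (p <= 3)%N -> `|c| <= 2 ->
  \sum_(i < 5) (offset i)%:~R ^+ p * weight R dl i c =
  (- c%:~R) ^+ p * 2 ^ (dl%:Z * (1 - p%:Z)).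
Proof.
move=> p3; elim: dl c => [|dl IHdl] c c2.
  rewrite (sum_offset_delta R (fun x => x%:~R ^+ p)) //.
  by rewrite mul0r expr0z mulr1 intrN.
under eq_bigr => i _ do rewrite /weight iterS -refineZ.
rewrite -refine_sum (refine_local _ _ _ IHdl) //.
under eq_refine => e do rewrite mulrC.
rewrite refineZ refine_monomial // mulrCA -expfzDr ?pnatr_eq0 //.
by congr (_ * _ ^ _); rewrite intS; ring.
Qed.

(** * Two-dimensional window sums *)

Definition box_sum {R : realType} (n : nat) (g : int * int -> R)
    (a : int * int) : R :=
  window_sum n (fun x => window_sum n (fun y => g (x, y)) a.2) a.1.

Lemma predict_tensor (R : realType) (g : int * int -> R) (x y : int) :
  predict g (x, y) =
  predict1 (fun x' => predict1 (fun y' => g (x', y')) y) x.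
Proof.
apply: eq_bigr => i _; rewrite mulr_sumr; apply: eq_bigr => j _ /=.
by rewrite mulrA.
Qed.

Lemma box_sum_predict (R : realType) (n : nat) (g : int * int -> R)
    (a c : int * int) :
  box_sum n.*2 (predict g) (2 * a.1 - c.1, 2 * a.2 - c.2) =
  refine (fun e1 =>
    refine (fun e2 => box_sum n g (a.1 - e1, a.2 - e2)) c.2) c.1.
Proof.
rewrite /box_sum /=.
(* Summing over [y] commutes with predicting in [x], so the one-dimensional
   identity applies in [y] first and then in [x]. *)
transitivity (window_sum n.*2
   (predict1 (fun x =>
      refine (fun e => window_sum n (fun y => g (x, y)) (a.2 - e)) c.2))
   (2 * a.1 - c.1)).
  apply: eq_bigr => i _; rewrite /window_sum.
  under eq_bigr => j _ do rewrite predict_tensor.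
  rewrite -predict1_sum; apply: eq_predict1 => x.
  exact: window_sum_predict1.
rewrite window_sum_predict1; apply: eq_refine => e1.
by rewrite /window_sum -refine_sum.
Qed.

Lemma box_sum_reconstruct (R : realType) (dl : nat) (f : int * int -> R)
    (k c : int * int) : `|c.1| <= 2 -> `|c.2| <= 2 ->
  box_sum (2 ^ dl) (reconstruct dl f)
    ((2 ^ dl)%N%:Z * k.1 - c.1, (2 ^ dl)%N%:Z * k.2 - c.2) =
  \sum_(i < 5) \sum_(j < 5) weight R dl i c.1 * weight R dl j c.2 *
    f (k.1 + offset i, k.2 + offset j).
Proof.
elim: dl c => [|dl IHdl] [c1 c2] /= c1_le c2_le.
  rewrite /box_sum /window_sum !big_ord1 !addr0 !mul1r.
  under eq_bigr => i _.
    under eq_bigr => j _ do rewrite -mulrA (mulrC (_ == - c2)%:R).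
    rewrite -mulr_sumr.
    rewrite (sum_offset_delta R (fun y => f (k.1 + offset i, k.2 + y))) // mulrC.
    over.
  by rewrite (sum_offset_delta R (fun x => f (k.1 + x, k.2 - c2))).
have doubleM x : (2 ^ dl.+1)%N%:Z * x = 2 * ((2 ^ dl)%N%:Z * x).
  by rewrite expnS PoszM mulrA.
rewrite !doubleM; have -> : (2 ^ dl.+1)%N = (2 ^ dl).*2 by rewrite expnS mul2n.
have := box_sum_predict R (2 ^ dl) (reconstruct dl f)
  ((2 ^ dl)%N%:Z * k.1, (2 ^ dl)%N%:Z * k.2) (c1, c2).
rewrite /= => ->.
transitivity (refine (fun e1 => refine (fun e2 =>
    \sum_(i < 5) \sum_(j < 5) weight R dl i e1 * weight R dl j e2 *
      f (k.1 + offset i, k.2 + offset j)) c2) c1).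
  apply: refine_local => // e1 e1_le; apply: refine_local => // e2 e2_le.
  exact: (IHdl (e1, e2)).
under eq_refine => e1.
  rewrite refine_sum; under eq_bigr => i _.
    rewrite refine_sum; under eq_bigr => j _.
      under eq_refine => e2 do rewrite mulrAC.
      rewrite refineZ mulrAC -mulrA mulrC.
      over.
    over.
  over.
rewrite refine_sum; apply: eq_bigr => i _.
rewrite refine_sum; apply: eq_bigr => j _.
by rewrite refineZ mulrC mulrA.
Qed.

(** * The flux as a difference of two box sums *)

Lemma big_cellB (R : realType) (dl : nat) (g : int * int -> R) (k : int * int) :
  \sum_(q <- cellB dl k) g q =
  box_sum (2 ^ dl) g ((2 ^ dl)%N%:Z * k.1, (2 ^ dl)%N%:Z * k.2).
Proof.
set pt := fun i j : nat =>
  ((2 ^ dl)%N%:Z * k.1 + i%:Z, (2 ^ dl)%N%:Z * k.2 + j%:Z).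
have cellB_perm : perm_eq (cellB dl k)
    [seq pt i j | i <- iota 0 (2 ^ dl), j <- iota 0 (2 ^ dl)].
  apply: uniq_perm; first exact: fset_uniq.
    apply: allpairs_uniq; rewrite ?iota_uniq // => -[i j] [i' j'] _ _ /=.
    by case=> /addrI [->] /addrI [->].
  move=> q; apply/imfset2P/allpairsP => [[i ii [j jj ->]]|[[i j] /= [ii jj ->]]].
    by exists (i, j).
  by exists i => //; exists j.
rewrite (perm_big _ cellB_perm) big_allpairs_dep /box_sum /window_sum.
rewrite -{1}(subn0 (2 ^ dl)%N) big_mkord; apply: eq_bigr => i _.
by rewrite -{1}(subn0 (2 ^ dl)%N) big_mkord.
Qed.

Lemma big_shiftB (R : realType) (dl : nat) (g : int * int -> R)
    (c k : int * int) :
  \sum_(q <- shiftB dl c k) g q =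
  box_sum (2 ^ dl) g ((2 ^ dl)%N%:Z * k.1 - c.1, (2 ^ dl)%N%:Z * k.2 - c.2).
Proof.
rewrite big_imfset /=; last first.
  by move=> [x y] [x' y'] _ _ /= [] /addIr -> /addIr ->.
rewrite (big_cellB R dl (fun q => g (q.1 - c.1, q.2 - c.2))).
apply: eq_bigr => i _; apply: eq_bigr => j _ /=.
by rewrite addrAC (addrAC _ _ (- c.2)).
Qed.

(** The cells common to both sets cancel. *)
Lemma sum_fsetD_diff (V : zmodType) (K : choiceType) (A B : {fset K})
    (g : K -> V) :
  \sum_(q <- (A `\` B)%fset) g q - \sum_(q <- (B `\` A)%fset) g q =
  \sum_(q <- A) g q - \sum_(q <- B) g q.
Proof.
have split_sum (X Y : {fset K}) : \sum_(q <- X) g q =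
    \sum_(q <- (X `&` Y)%fset) g q + \sum_(q <- (X `\` Y)%fset) g q.
  rewrite (big_fsetID _ (mem Y)) /=; congr (_ + _); apply: eq_fbigl => q.
  - by rewrite !inE.
  - by rewrite !inE andbC.
rewrite (split_sum A B) (split_sum B A) (fsetIC B A).
by rewrite opprD addrACA subrr add0r.
Qed.

Lemma stream_flux_box_sum (R : realType) (dl : nat) (f : int * int -> R)
    (c k : int * int) :
  let N := (2 ^ dl)%N in
  stream_flux dl c f k =
  box_sum N (reconstruct dl f) (N%:Z * k.1 - c.1, N%:Z * k.2 - c.2) -
  box_sum N (reconstruct dl f) (N%:Z * k.1 - 0, N%:Z * k.2 - 0).
Proof.
move=> N; rewrite /stream_flux sum_fsetD_diff big_shiftB big_cellB.
by rewrite !subr0.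
Qed.

(** * Flattened weights *)

Definition flux_weights (R : realType) (dl : nat) (c : int * int) : 'M[R]_5 :=
  \matrix_(i, j) (weight R dl i c.1 * weight R dl j c.2
                  - weight R dl i 0 * weight R dl j 0).

Lemma flux_weights_flattened (R : realType) (dl : nat) (c : int * int) :
  `|c.1| <= 2 -> `|c.2| <= 2 ->
  is_flattened_weights dl c (flux_weights R dl c).
Proof.
move=> c1_le c2_le f k; rewrite stream_flux_box_sum.
rewrite box_sum_reconstruct //.
rewrite (box_sum_reconstruct _ _ _ _ (0, 0)) // -sumrB.
apply: eq_bigr => i _; rewrite -sumrB; apply: eq_bigr => j _.
by rewrite mxE mulrBl.
Qed.

(** Each weight is read off as the flux of the indicator of one cell. *)
Lemma flattened_weights_inj (R : realType) (dl : nat) (c : int * int)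
    (C D : 'M[R]_5) :
  is_flattened_weights dl c C -> is_flattened_weights dl c D -> C = D.
Proof.
have offset_inj : injective offset.
  by move=> i j; rewrite /offset => ij; apply: val_inj => /=; lia.
have entryE (E : 'M[R]_5) i j : is_flattened_weights dl c E ->
    E i j = stream_flux dl c (fun q => (q == (offset i, offset j))%:R) (0, 0).
  move=> ->; rewrite (bigD1 i) //= (bigD1 j) //= !add0r eqxx mulr1.
  rewrite !big1 ?addr0 // => [i' /negbTE ni|j' /negbTE nj].
    apply: big1 => j' _.
    by rewrite !add0r xpair_eqE !(inj_eq offset_inj) ni mulr0.
  by rewrite !add0r xpair_eqE !(inj_eq offset_inj) nj andbF mulr0.
by move=> flatC flatD; apply/matrixP => i j; rewrite !entryE.
Qed.

(** The term [0 ^+ px * 0 ^+ py] comes from the window with shift 0; it makes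
    one formula cover the vanishing moment of order [(0, 0)] too. *)
Lemma flux_weights_moment (R : realType) (dl : nat) (c : int * int)
    (px py : nat) :
  `|c.1| <= 2 -> `|c.2| <= 2 -> (px <= 3)%N -> (py <= 3)%N ->
  \sum_(i < 5) \sum_(j < 5) (offset i)%:~R ^+ px * (offset j)%:~R ^+ py *
    flux_weights R dl c i j =
  ((- c.1%:~R) ^+ px * (- c.2%:~R) ^+ py - 0 ^+ px * 0 ^+ py)
    / 2 ^ (dl%:Z * (px%:Z + py%:Z - 2)).
Proof.
move=> c1_le c2_le px3 py3.
have tensor_moment (a b : int) : `|a| <= 2 -> `|b| <= 2 ->
    \sum_(i < 5) \sum_(j < 5) (offset i)%:~R ^+ px * (offset j)%:~R ^+ py *
      (weight R dl i a * weight R dl j b) =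
    (- a%:~R) ^+ px * (- b%:~R) ^+ py / 2 ^ (dl%:Z * (px%:Z + py%:Z - 2)).
  move=> a_le b_le.
  under eq_bigr => i _ do under eq_bigr => j _ do rewrite mulrACA.
  rewrite -big_distrlr /= !weight_moment // mulrACA -expfzDr ?pnatr_eq0 //.
  by rewrite invr_expz; congr (_ * _ ^ _); ring.
under eq_bigr => i _ do under eq_bigr => j _ do rewrite mxE mulrBr.
under eq_bigr => i _ do rewrite sumrB.
by rewrite sumrB !tensor_moment // oppr0 mulrBl.
Qed.

Theorem proposition6p3 (R : realType) :
  stream_phase_matches R
    (fun c : int * int => Num.max `|c.1| `|c.2| <= 2) 3.
Proof.
move=> dl c; rewrite ge_max => /andP[c1_le c2_le].
exists (flux_weights R dl c); split; first split.
- exact: flux_weights_flattened.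
- by move=> D; apply: flattened_weights_inj; apply: flux_weights_flattened.
split.
  have := flux_weights_moment R dl c 0 0 c1_le c2_le isT isT.
  rewrite !expr0 subrr mul0r => moment0; rewrite -[RHS]moment0.
  by apply: eq_bigr => i _; apply: eq_bigr => j _; rewrite !mul1r.
move=> px py px3 py3 p_neq0; rewrite flux_weights_moment //.
have -> : 0 ^+ px * 0 ^+ py = 0 :> R; last by rewrite subr0.
rewrite !expr0n; case: px py p_neq0 {px3 py3} => [|px] [|py] //= _.
all: by rewrite ?(mul0r, mulr0).
Qed.
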